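(* Let $\alpha\in\mathbb{R}$ and let $\alpha=[a_0,a_1,a_2,\ldots]_\downarrow$ be its odd continued fraction expansion, of length $L\in\{\infty,1,3,5,\ldots\}$. Let $m\in\mathbb{N}$. Then the following three conditions are equivalent: (C1) $\alpha\in\mathcal{H}_m$. (C2) $m\mid a_k$ for all odd $k$ with $1\le k<L$. (C3) $m\mid q_k$ for all odd $k$ with $1\le k<L$, where $q_k=q_k(\alpha)$ are the denominators of the convergents of $\alpha$ computed from this expansion.
   Context: $\mathbb{N}$ denotes the positive integers, $[x]$ the integer part (floor) of $x\in\mathbb{R}$, and $\langle x\rangle=x-[x]$ the fractional part. For $m\in\mathbb{N}$, $$\mathcal{H}_m=\Big\{\alpha\in\mathbb{R}\;:\;\mathrm{card}\{1\le k\le n : \langle k\alpha\rangle<\tfrac1m\}\ge \tfrac nm\ \text{ for all } n\in\mathbb{N}\Big\}.$$ A continued fraction expansion $[a_0,a_1,a_2,\ldots]_\downarrow$ (simple continued fraction $a_0+\frac{1}{a_1+\frac{1}{a_2+\cdots}}$) has $a_0\in\mathbb{Z}$ and $a_k\in\mathbb{N}$ for $k\ge1$. Its length $L$ is the number of entries: $[a_0,\ldots,a_n]_\downarrow$ has length $n+1$, and an infinite expansion has $L=\infty$. Every irrational has a unique (infinite) expansion. Every rational has exactly two finite expansions, whose lengths are consecutive integers (the last entry $1$ is allowed). The odd continued fraction expansion of $\alpha$ is the unique expansion of $\alpha$ with length $L\in\{\infty,1,3,5,\ldots\}$. The denominators $q_k$ ($0\le k<L$) are defined by $q_0=1$, $q_1=a_1$,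 $q_k=a_kq_{k-1}+q_{k-2}$ for $2\le k<L$. *)

(* Defs.v *)
From mathcomp Require Import all_boot all_order all_algebra.
From mathcomp Require Import all_classical all_reals all_analysis.
Set Implicit Arguments.
Unset Strict Implicit.
Unset Printing Implicit Defensive.
Import Order.TTheory GRing.Theory Num.Theory.
Import numFieldNormedType.Exports.

Local Open Scope classical_set_scope.
Local Open Scope ring_scope.

Definition frac_part (R : realType) (x : R) : R := x - (Num.floor x)%:~R.

Definition Hset (R : realType) (m : nat) : set R :=
  [set alpha : R | forall n : nat, (0 < n)%N ->
     n%:R / m%:R <=
     (#|[pred k : 'I_n.+1 | (1 <= k)%N
          && (frac_part (k%:R * alpha) < 1 / m%:R)]|%:R : R)].

(* The expansion [a_0, a_1, ...] of length L is the pair of a : nat -> int and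
   L : option nat, with None standing for an infinite length; the values a k
   for k >= L are irrelevant. *)
Definition lt_length (k : nat) (L : option nat) : bool :=
  if L is Some l then (k < l)%N else true.

(* cf_value R a n is [a_0, ..., a_n], which has n + 1 entries. *)
Fixpoint cf_value (R : realType) (a : nat -> int) (n : nat) : R :=
  if n is n'.+1 then (a 0%N)%:~R + 1 / cf_value R (fun k => a k.+1) n'
  else (a 0%N)%:~R.

Definition cf_expansion (R : realType) (a : nat -> int) (L : option nat)
    (alpha : R) : Prop :=
  (forall k : nat, (1 <= k)%N -> lt_length k L -> 1 <= a k) /\
  match L with
  | Some l => (0 < l)%N /\ alpha = cf_value R a l.-1
  | None => cf_value R a n @[n --> \oo] --> alpha
  end.

Definition odd_cf_expansion (R : realType) (a : nat -> int) (L : option nat)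
    (alpha : R) : Prop :=
  cf_expansion a L alpha /\ (if L is Some l then odd l else true).

Fixpoint cf_denom (a : nat -> int) (k : nat) : int :=
  match k with
  | 0%N => 1
  | 1%N => a 1%N
  | (k''.+1 as k').+1 => a k * cf_denom a k' + cf_denom a k''
  end.

(* Main.v *)
Require Import Defs.
From mathcomp Require Import all_boot all_order all_algebra.
From mathcomp Require Import all_classical all_reals all_analysis.
From mathcomp Require Import zify ring.
Set Implicit Arguments.
Unset Strict Implicit.
Unset Printing Implicit Defensive.
Import Order.TTheory GRing.Theory Num.Theory.
Import numFieldNormedType.Exports.

Local Open Scope classical_set_scope.
Local Open Scope ring_scope.

(** That heaviness, that is membership in H_m, amounts to divisibility by m of
    the entries of odd index is a renormalization argument.  Write
    alpha = a_0 + 1/beta with beta = a_1 + gamma and gamma = 1/x, where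
    x >= 1 is the complete quotient [a_2, a_3, ...].  Membership in H_m depends
    only on alpha modulo 1, so alpha may be replaced by 1/beta.

    An integer j with floor (j / beta) = l lies in the block
    [ceil (l beta), ceil ((l+1) beta)), and then the fractional part of
    j / beta is less than 1/m exactly when j < l beta + beta/m.  So each
    block consists of a run of visits to [0, 1/m) followed by a run of
    non-visits, with
    ceil (l beta + beta/m) - ceil (l beta) visits in all
    ([visits_block], [visits_ceil]).  The same holds with gamma in place of
    beta, where some blocks may be empty.  If m divides a_1, both ceilings for
    beta differ from those for gamma by integers, namely l a_1 + a_1/m and
    l a_1, so the l-th block for beta has a_1/m visits more than the l-th block
    for gamma ([visits_renorm]).  Hence the excess of visits over n/m is the
    same for 1/beta at time ceil (l beta) and for x at time ceil (l gamma)
    ([heavy_at_renorm]).  As gamma <= 1, the numbers ceil (l gamma) exhaust the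
    natural numbers, and inside a block the excess first grows and then falls,
    so it is least at the ends of blocks.  Consequently, when m divides a_1,
    alpha is in H_m if and only if x is ([heavy_descend], [heavy_ascend]).
    If alpha is in H_m then m does divide a_1, since the first block of 1/beta,
    of length a_1 + 1, has too few visits otherwise ([heavy_dvdn]).

    That heaviness forces m to divide a_k for all odd k follows by induction
    on k.  For the converse the expansion may be infinite; but heaviness of
    alpha at time n only uses heaviness of x at smaller times, so the induction
    is on n.  The oddness of a finite length makes the entries a_1, a_2 come in
    pairs, so that the recursion stops at an integer.

    Divisibility of the entries and of the denominators of odd index are
    equivalent because q_k = a_k q_(k-1) + q_(k-2), where
    q_(k-1) is coprime to q_(k-2) and so to m, once m divides q_(k-2). *)

(** * Visits of multiples to an initial interval, block by block *)

Section Visits.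
Variable R : realType.
Implicit Types (x y : R) (m n k l : nat).

Definition ceiln x : nat := `|Num.ceil x|%N.

Lemma ceiln_le x n : 0 <= x -> (ceiln x <= n)%N = (x <= n%:R).
Proof.
move=> x0; rewrite -[n%:R]/(n%:~R : R) -ceil_le_int /ceiln -lez_nat gez0_abs //.
by rewrite ceil_ge0 (lt_le_trans _ x0) // ltrN10.
Qed.

Lemma lt_ceiln x n : 0 <= x -> (n < ceiln x)%N = (n%:R < x).
Proof. by move=> x0; rewrite ltnNge ceiln_le // -ltNge. Qed.

Lemma leq_ceiln x y : 0 <= x -> x <= y -> (ceiln x <= ceiln y)%N.
Proof.
move=> x0 xy; rewrite ceiln_le // (le_trans xy) // -ceiln_le //.
exact: le_trans xy.
Qed.

Lemma ceilnDn x n : 0 <= x -> ceiln (n%:R + x) = (n + ceiln x)%N.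
Proof.
move=> x0; rewrite /ceiln ceilDzr ?natr_int // -[n%:R]/(n%:~R : R) intrKceil.
have : 0 <= Num.ceil x by rewrite ceil_ge0 (lt_le_trans _ x0) // ltrN10.
by case: (Num.ceil x) => // c _; rewrite -PoszD.
Qed.

Definition visit m x k : bool := frac_part (k%:R * x) < 1 / m%:R.

(** The count starts at k = 0, which is always a visit.  This makes the count up
    to ceil (l y) a sum over whole blocks, the block of l = 0 included. *)
Definition visits m x n : nat := (\sum_(k < n) visit m x k)%N.

(** This is the condition defining H_m at time n - 1, with the visit at 0
    included: (n - 1) / m <= visits m x n - 1, cleared of denominators and of
    subtractions. *)
Definition heavy_at m x n : bool := (n + m <= m * visits m x n + 1)%N.

Lemma visitsS m x n : visits m x n.+1 = (visits m x n + visit m x n)%N.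
Proof. by rewrite /visits big_ord_recr. Qed.

Lemma visits0 m x : visits m x 0 = 0%N.
Proof. by rewrite /visits big_ord0. Qed.

Lemma visit0 m x : (0 < m)%N -> visit m x 0.
Proof.
by move=> m0; rewrite /visit /frac_part mul0r floor0 subr0 divr_gt0 ?ltr0n.
Qed.

Lemma visits1 m x : (0 < m)%N -> visits m x 1 = 1%N.
Proof. by move=> m0; rewrite visitsS visits0 visit0. Qed.

Lemma visit_addz m x (z : int) k : visit m (z%:~R + x) k = visit m x k.
Proof.
have kz : k%:R * z%:~R = (k%:Z * z)%:~R :> R by rewrite intrM.
rewrite /visit /frac_part mulrDr kz floorDzr ?intr_int // intrD intrKfloor.
by congr (_ < _); ring.
Qed.

Lemma heavy_at_addz m x (z : int) n : heavy_at m (z%:~R + x) n = heavy_at m x n.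
Proof.
by rewrite /heavy_at /visits; under eq_bigr do rewrite visit_addz.
Qed.

Lemma heavy_at_int m (z : int) n : (0 < m)%N -> (0 < n)%N ->
  heavy_at m (z%:~R : R) n.
Proof.
move=> m0 n0; rewrite -[z%:~R]addr0 heavy_at_addz /heavy_at /visits.
have v k : visit m (0 : R) k.
  by rewrite /visit mulr0; have := visit0 0 m0; rewrite /visit mul0r.
under eq_bigr do rewrite v.
rewrite sum_nat_const card_ord muln1; nia.
Qed.

(** Discarding the visit at k = 0 turns heaviness at time n + 1 into the condition
    of H_m for n; at time 1 heaviness is automatic. *)
Lemma HsetP m x : (0 < m)%N ->
  Hset m x <-> forall n, (0 < n)%N -> heavy_at m x n.
Proof.
move=> m0; rewrite /Hset /=.
have E n : #|[pred k : 'I_n.+1 | (1 <= k)%N &&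
    (frac_part (k%:R * x) < 1 / m%:R)]| = (visits m x n.+1).-1.
  rewrite -sum1_card big_mkcond big_ord_recl /= add0n.
  by rewrite /visits big_ord_recl /= visit0 //= add1n.
have pos n : (0 < visits m x n.+1)%N.
  by rewrite /visits big_ord_recl visit0.
have H n : (n%:R / m%:R <= (visits m x n.+1).-1%:R :> R) = heavy_at m x n.+1.
  rewrite ler_pdivrMr ?ltr0n // -natrM ler_nat /heavy_at.
  have := pos n; case: (visits _ _ _) => // v _ /=; lia.
split=> h n n0.
  case: n n0 => // -[|n] _; first by rewrite /heavy_at visits1 // muln1 addnC.
  by rewrite -H -E; apply: h.
by rewrite E H; apply: h.
Qed.

Section Blocks.
Variables (m : nat) (y : R).
Hypotheses (m0 : (0 < m)%N) (y0 : 0 < y).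

Let b0 l : 0 <= l%:R * y. Proof. by rewrite mulr_ge0 // ltW. Qed.
Let t0 l : 0 <= l%:R * y + y / m%:R.
Proof. by rewrite addr_ge0 // divr_ge0 // ltW. Qed.

(** Within the block, the floor of k / y is l, so the condition on the fractional
    part reads k / y - l < 1 / m. *)
Lemma visit_block l k :
  (ceiln (l%:R * y) <= k < ceiln (l.+1%:R * y))%N ->
  visit m y^-1 k = (k < ceiln (l%:R * y + y / m%:R))%N.
Proof.
rewrite ceiln_le // !lt_ceiln // => /andP[lk kl].
rewrite /visit /frac_part.
have -> : Num.floor (k%:R * y^-1) = l.
  apply: floor_def; rewrite ler_pdivlMr // lk ltr_pdivrMr //.
  by rewrite intrD -[l%:~R]/(l%:R) -[1%:~R]/(1%:R) natr1.
rewrite -[l%:~R]/(l%:R : R) ltrBlDr ltr_pdivrMr //.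
by congr (_ < _); ring.
Qed.

Lemma visits_block l n :
  (ceiln (l%:R * y) <= n <= ceiln (l.+1%:R * y))%N ->
  visits m y^-1 n = (visits m y^-1 (ceiln (l%:R * y)) +
    (minn n (ceiln (l%:R * y + y / m%:R)) - ceiln (l%:R * y)))%N.
Proof.
case/andP; elim: n => [|n IHn].
  by rewrite leqn0 => /eqP -> _; rewrite min0n sub0n addn0.
rewrite leq_eqVlt => /predU1P[<- _|]; first by lia.
rewrite ltnS => ln nl; rewrite visitsS IHn // 1?ltnW //.
rewrite (visit_block (l := l)); last by rewrite ln.
have : (ceiln (l%:R * y) <= ceiln (l%:R * y + y / m%:R))%N.
  by rewrite leq_ceiln // lerDl divr_ge0 // ltW.
by lia.
Qed.

(** The run of visits fits in the block because y / m <= y. *)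
Lemma visits_ceil l :
  visits m y^-1 (ceiln (l.+1%:R * y)) = (visits m y^-1 (ceiln (l%:R * y)) +
    (ceiln (l%:R * y + y / m%:R) - ceiln (l%:R * y)))%N.
Proof.
rewrite (@visits_block l); last first.
  by rewrite leqnn andbT leq_ceiln // ler_pM2r // ler_nat.
congr (_ + (_ - _))%N; apply/minn_idPr/leq_ceiln => //.
by rewrite -natr1 mulrDl mul1r lerD2l ler_pdivrMr ?ltr0n // ler_peMr ?ler1n ?(ltW y0).
Qed.

End Blocks.
End Visits.

(** * Renormalization from the number 1 / (a + g) to the number 1 / g *)

Section Renormalization.
Variables (R : realType) (m : nat) (a : nat) (g : R).
Hypotheses (m0 : (0 < m)%N) (a0 : (0 < a)%N) (g0 : 0 < g) (g1 : g <= 1).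

Let b0 : 0 < a%:R + g. Proof. by rewrite addr_gt0 // ltr0n. Qed.
Let lg0 l : 0 <= l%:R * g. Proof. by rewrite mulr_ge0 // ltW. Qed.

Lemma ceiln_mulDn l : ceiln (l%:R * (a%:R + g)) = (l * a + ceiln (l%:R * g))%N.
Proof. by rewrite mulrDr -natrM ceilnDn. Qed.

Lemma ceilnS_mul l : (ceiln (l.+1%:R * g) <= (ceiln (l%:R * g)).+1)%N.
Proof.
rewrite ceiln_le // -natr1 -[in leRHS]natr1 mulrDl mul1r lerD //.
by rewrite -ceiln_le.
Qed.

Lemma ceiln_mul_gt0 l : (0 < l)%N -> (0 < ceiln (l%:R * g))%N.
Proof. by move=> l0; rewrite lt_ceiln // mulr_gt0 // ltr0n. Qed.

Lemma ceiln_mul1 : ceiln (1%:R * g) = 1%N.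
Proof.
by apply/eqP; rewrite eqn_leq ceiln_mul_gt0 // andbT ceiln_le // mul1r.
Qed.

Lemma ceiln_mul0 : ceiln (0%:R * g) = 0%N.
Proof. by apply/eqP; rewrite -leqn0 ceiln_le // mul0r. Qed.

(** Steps of size g <= 1 cannot jump over a unit interval (n - 1, n]; the largest
    l with l g <= n lands in it. *)
Lemma ceiln_mul_surj n : exists l, ceiln (l%:R * g) = n.
Proof.
have [l ln] : exists l : nat, l%:R <= n%:R / g < l.+1%:R.
  exists (Num.truncn (n%:R / g)); apply: truncn_itv.
  by rewrite divr_ge0 // ltW.
exists l; apply/eqP; rewrite eqn_leq ceiln_le // -ler_pdivlMr //.
case/andP: ln => -> /=; case: n => // n.
rewrite ltr_pdivrMr // -!natr1 mulrDl mul1r => ln.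
by rewrite lt_ceiln // -(ltrD2r g) (le_lt_trans _ ln) // lerD2l.
Qed.

(** At time a + 1 = ceil (a + g), the end of the first block, there are
    ceil ((a + g) / m) <= floor (a / m) + 1 visits, while heaviness requires m
    times this number to be at least a + m. *)
Lemma heavy_dvdn :
  (forall n, (0 < n)%N -> heavy_at m (a%:R + g)^-1 n) -> (m %| a)%N.
Proof.
move=> /(_ _ (ltn0Sn a)); rewrite /heavy_at.
have E : a.+1 = ceiln (1%:R * (a%:R + g)).
  by rewrite ceiln_mulDn ceiln_mul1 mul1n addn1.
rewrite {2}E visits_ceil // mul0r add0r.
have -> : ceiln (0 : R) = 0%N by apply/eqP; rewrite -leqn0 ceiln_le.
rewrite visits0 add0n subn0.
have : (ceiln ((a%:R + g) / m%:R) <= (a %/ m).+1)%N.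
  rewrite ceiln_le ?divr_ge0 ?(ltW b0) // ler_pdivrMr ?ltr0n // -natrM.
  apply: (@le_trans _ _ a.+1%:R); first by rewrite -natr1 lerD2l.
  by rewrite ler_nat ltn_ceil.
rewrite /dvdn; move: (divn_eq a m).
move: (ceiln _) (a %/ m)%N (a %% m)%N => c d r; nia.
Qed.

Hypothesis ma : (m %| a)%N.

(** The shift (l a + a / m) of the end of a run of visits is an integer because m
    divides a, so it can be pulled out of the ceiling. *)
Lemma visits_renorm l :
  visits m (a%:R + g)^-1 (ceiln (l%:R * (a%:R + g))) =
  (l * (a %/ m) + visits m g^-1 (ceiln (l%:R * g)))%N.
Proof.
elim: l => [|l IHl].
  by rewrite ceiln_mulDn ceiln_mul0 !visits0.
rewrite !visits_ceil // IHl ceiln_mulDn.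
have -> : l%:R * (a%:R + g) + (a%:R + g) / m%:R =
    (l * a + a %/ m)%:R + (l%:R * g + g / m%:R).
  by rewrite natrD natrM natf_div //; ring.
rewrite ceilnDn ?addr_ge0 // ?divr_ge0 // ?ltW //.
have : (ceiln (l%:R * g) <= ceiln (l%:R * g + g / m%:R))%N.
  by rewrite leq_ceiln // lerDl divr_ge0 // ltW.
rewrite mulSn; move: (a %/ m)%N (ceiln _) (ceiln _) (visits _ _ _) => ? ? ? ?; lia.
Qed.

Lemma heavy_at_renorm l :
  heavy_at m (a%:R + g)^-1 (ceiln (l%:R * (a%:R + g))) =
  heavy_at m g^-1 (ceiln (l%:R * g)).
Proof.
rewrite /heavy_at visits_renorm ceiln_mulDn mulnDr.
have -> : (m * (l * (a %/ m)) = l * a)%N by rewrite mulnCA [(m * _)%N]mulnC divnK.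
by rewrite -!addnA leq_add2l.
Qed.

Lemma heavy_descend n :
  (forall k, (0 < k)%N -> heavy_at m (a%:R + g)^-1 k) ->
  (0 < n)%N -> heavy_at m g^-1 n.
Proof.
have [l <-] := ceiln_mul_surj n => h c0.
by rewrite -heavy_at_renorm h // ceiln_mulDn ltn_addl.
Qed.

(** Only times k < n are used for 1 / g, which allows an induction on time.  With
    n - 1 in the l-th block, either n is past the run of visits, and then heaviness
    at the end of the block is stronger; or all points of the block before n are
    visits, and then heaviness at n follows from heaviness at the beginning of
    the block. *)
Lemma heavy_ascend n :
  (forall k, (0 < k < n)%N -> heavy_at m g^-1 k) ->
  (0 < n)%N -> heavy_at m (a%:R + g)^-1 n.
Proof.
move=> IH; case: n IH => // -[_ _|n IH _].
  by rewrite /heavy_at visits1 // muln1 addnC.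
have [l] : exists l : nat, l%:R <= n.+1%:R / (a%:R + g) < l.+1%:R.
  exists (Num.truncn (n.+1%:R / (a%:R + g))); apply: truncn_itv.
  by rewrite divr_ge0 // ltW.
rewrite ler_pdivlMr // ltr_pdivrMr // -ceiln_le ?mulr_ge0 // ?ltW //.
rewrite -lt_ceiln ?mulr_ge0 // ?ltW // => /andP[ln nl].
(* The end of the block corresponds to the time ceil ((l + 1) g), which is at most
   ceil (l g) + 1 and hence less than n.+2: for l > 0 because the block begins at
   l a + ceil (l g) <= n.+1, and for l = 0 because it is 1. *)
have hS : heavy_at m (a%:R + g)^-1 (ceiln (l.+1%:R * (a%:R + g))).
  rewrite heavy_at_renorm IH // ceiln_mul_gt0 //=.
  have [->|l0] := posnP l; first by rewrite ceiln_mul1.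
  move: ln (ceilnS_mul l); rewrite ceiln_mulDn.
  move: (ceiln _) (ceiln _) => c d; nia.
move: hS; rewrite {1}/heavy_at visits_ceil //.
rewrite /heavy_at [X in (_ -> _ <= m * X + 1)%N](@visits_block _ _ _ _ _ l) //; last first.
  by rewrite nl andbT leqW.
have [tn|nt] := leqP (ceiln (l%:R * (a%:R + g) + (a%:R + g) / m%:R)) n.+2.
  by apply: leq_trans; rewrite leq_add2r.
move=> _.
have [l0|l0] := posnP l.
  (* In the block of 0 every point before n.+2 is a visit. *)
  rewrite l0 ceiln_mulDn ceiln_mul0 visits0 subn0; nia.
have : heavy_at m (a%:R + g)^-1 (ceiln (l%:R * (a%:R + g))).
  rewrite heavy_at_renorm IH // ceiln_mul_gt0 //=.
  by move: ln; rewrite ceiln_mulDn; move: (ceiln _) => c; nia.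
rewrite /heavy_at; move: ln; move: (ceiln _) (visits _ _ _) => c v; nia.
Qed.

End Renormalization.

(** * Divisibility of entries and of denominators *)

Section Denominators.
Implicit Types (a : nat -> int) (m k : nat).

Lemma coprimez_cf_denom a k : coprimez (cf_denom a k.+1) (cf_denom a k).
Proof.
elim: k => [|k IHk]; first by rewrite /= coprimezE /= coprimen1.
rewrite [cf_denom a k.+2]/= -/(cf_denom a k.+1) coprimez_sym /coprimez.
by rewrite gcdzMDl.
Qed.

(** For odd k, the recurrence gives q_k = a_k q_(k-1) modulo m because m divides
    q_(k-2).  The other factor q_(k-1) is invertible modulo m, since it is
    coprime to q_(k-2).  The predicate P stands for the indices of entries
    of the expansion. *)
Lemma dvdz_cf_denom a m (P : nat -> bool) :
  (forall j k, (j <= k)%N -> P k -> P j) ->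
  (forall k, odd k -> (1 <= k)%N -> P k -> (m%:Z %| a k)%Z) <->
  (forall k, odd k -> (1 <= k)%N -> P k -> (m%:Z %| cf_denom a k)%Z).
Proof.
move=> Pmono.
have denom_rec k : cf_denom a k.+3 = a k.+3 * cf_denom a k.+2 + cf_denom a k.+1.
  by [].
split=> h.
- move=> k; have [n] := ubnP k; elim: n k => // n IHn [|[|[|k]]] //.
    by move=> _ _ _ P1; apply: h.
  move=> kn ok _ Pk; rewrite denom_rec rpredD //; first by rewrite dvdz_mulr ?h.
  apply: IHn => //; [by lia | by move: ok => /=; rewrite !negbK |].
  by apply: Pmono Pk; lia.
- move=> [|[|[|k]]] // ok _ Pk; first by have := h 1%N isT isT Pk.
  have dk : (m%:Z %| cf_denom a k.+1)%Z.
    apply: h => //; first by move: ok => /=; rewrite !negbK.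
    by apply: Pmono Pk; lia.
  have := h _ ok isT Pk; rewrite denom_rec rpredDr // Gauss_dvdzl //.
  (* A Bezout relation between q_(k-1) and q_(k-2), the latter a multiple of m,
     is one between q_(k-1) and m. *)
  rewrite coprimez_sym; apply/coprimezP.
  have /coprimezP[[u v] /= uv] := coprimez_cf_denom a k.+1.
  have /dvdzP[c cE] := dk.
  by exists (u, v * c); rewrite /= -mulrA -cE.
Qed.

End Denominators.

(** * Complete quotients of an expansion *)

Section Tails.
Variable R : realType.
Implicit Types (a : nat -> int) (L : option nat) (x : R).

Definition tail a : nat -> int := fun k => a k.+1.

Lemma cf_valueS a n : cf_value R a n.+1 = (a 0%N)%:~R + 1 / cf_value R (tail a) n.
Proof. by []. Qed.

Lemma cf_value_bounds a n : (forall k, (1 <= k <= n)%N -> 1 <= a k) ->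
  (a 0%N)%:~R <= cf_value R a n <= (a 0%N)%:~R + 1.
Proof.
elim: n a => [|n IHn] a ha; first by rewrite /= lexx lerDl ler01.
have ta k : (k <= n)%N -> 1 <= tail a k by move=> kn; apply: ha.
have /andP[t0 _] : (tail a 0)%:~R <= cf_value R (tail a) n <= (tail a 0)%:~R + 1.
  by apply: IHn => k /andP[_]; apply: ta.
have t1 : 1 <= cf_value R (tail a) n.
  by apply: le_trans t0; rewrite (ler_int R 1) ta.
rewrite cf_valueS lerDl lerD2l divr_ge0 //= ?(le_trans _ t1) //.
by rewrite ler_pdivrMr ?mul1r // (lt_le_trans _ t1).
Qed.

(** For an infinite expansion the values w_n of the tail satisfy
    v_(n+1) = a_0 + 1 / w_n, where v_n are the values of the expansion.  As w_n is
    at most a_1 + 1, the limit x - a_0 of 1 / w_n is not 0, so w_n converges. *)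
Lemma cf_expansion_tail a L x : cf_expansion a L x -> lt_length 1 L ->
  exists y, [/\ cf_expansion (tail a) (omap predn L) y, 1 <= y &
                x = (a 0%N)%:~R + y^-1].
Proof.
move=> [a1 ax] L1.
have ta k : lt_length k (omap predn L) -> 1 <= tail a k.
  by move=> kL; apply: a1 => //; case: L kL {ax L1} => //= l; rewrite ltn_predRL.
have bnd n : lt_length n (omap predn L) ->
    1 <= cf_value R (tail a) n <= (a 1%N)%:~R + 1.
  move=> nL.
  have tk k : (k <= n)%N -> 1 <= tail a k.
    move=> kn; apply: ta; case: L nL {a1 ax L1} => //= l nl.
    exact: leq_ltn_trans nl.
  have /andP[t0 ->] : (tail a 0)%:~R <= cf_value R (tail a) n <= (tail a 0)%:~R + 1.
    by apply: cf_value_bounds => k /andP[_]; apply: tk.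
  by rewrite andbT (le_trans _ t0) // (ler_int R 1) tk.
case: L L1 a1 ax ta bnd => [[|[|l]]|] //= _ a1 ax ta bnd.
  case: ax => _ ->; exists (cf_value R (tail a) l).
  split; [|by have /andP[] := bnd l (leqnn _)|by rewrite div1r].
  by split=> // k k1 /ta.
set w := cf_value R (tail a).
have w_gt0 n : 0 < w n by have /andP[/(lt_le_trans _)-> //] := bnd n isT.
have cw : (w n)^-1 @[n --> \oo] --> x - (a 0%N)%:~R.
  have -> : (fun n => (w n)^-1) = (fun n => cf_value R a n.+1 - (a 0%N)%:~R).
    by apply/funext => n; rewrite cf_valueS div1r addrC addKr.
  apply: cvgB (cvg_cst _).
  by rewrite (cvg_shiftS (cf_value R a)).
set z := x - _ in cw.
have a1_gt0 : 0 < (a 1%N)%:~R + 1 :> R.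
  by rewrite addr_gt0 // ltr0z (lt_le_trans _ (ta 0%N isT)).
have z_gt0 : 0 < z.
  have : ((a 1%N)%:~R + 1)^-1 <= z.
    rewrite -(cvg_lim _ cw) //; apply: limr_ge; first by apply/cvg_ex; exists z.
    by near=> n; rewrite lef_pV2 ?posrE //; have /andP[] := bnd n isT.
  by apply: lt_le_trans; rewrite invr_gt0.
have cw' : w n @[n --> \oo] --> z^-1.
  apply/(cvgVP _ _); first by rewrite invr_eq0 gt_eqF.
  by rewrite invrK.
exists z^-1; split; last by rewrite invrK addrC subrK.
  by split=> [k k1 _|//]; apply: ta.
rewrite -(cvg_lim _ cw') //; apply: limr_ge; first by apply/cvg_ex; exists z^-1.
by near=> n; have /andP[] := bnd n isT.
Unshelve. all: by end_near. Qed.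

(** An odd length greater than 1 is at least 3, so two entries can be removed; the
    length stays odd. *)
Lemma odd_cf_expansion_tail2 a L x : odd_cf_expansion a L x -> lt_length 1 L ->
  exists y, [/\ odd_cf_expansion (tail (tail a)) (omap predn (omap predn L)) y,
                1 <= y & x = (a 0%N)%:~R + ((a 1%N)%:~R + y^-1)^-1].
Proof.
move=> [ax oL] L1.
have [y [ay y1 ->]] := cf_expansion_tail ax L1.
have L2 : lt_length 1 (omap predn L) by case: L L1 oL {ax ay} => // -[|[|[]]].
have [z [az z1 yE]] := cf_expansion_tail ay L2.
exists z; split=> //; last by rewrite yE.
split=> //; case: L L1 L2 oL {ax ay az} => // -[|[|[|l]]] //= _ _.
by rewrite negbK.
Qed.

End Tails.

(** * Heaviness and divisibility of the odd entries *)

Section Equivalence.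
Variable R : realType.
Implicit Types (a : nat -> int) (L : option nat) (x : R) (m n k : nat).

Lemma lt_length_pred2 k L :
  lt_length k (omap predn (omap predn L)) = lt_length k.+2 L.
Proof. by case: L => //= l; rewrite !ltn_predRL. Qed.

Lemma lt_lengthW j k L : (j <= k)%N -> lt_length k L -> lt_length j L.
Proof. by case: L => // l; apply: leq_ltn_trans. Qed.

Lemma cf_expansion_nat1 a L x : cf_expansion a L x -> lt_length 1 L ->
  exists2 d : nat, (0 < d)%N & a 1%N = d.
Proof.
case=> a1 _ L1; have := a1 1%N isT L1.
by case: (a 1%N) => // d d1; exists d.
Qed.

Lemma heavy_dvdz m a L x : (0 < m)%N -> odd_cf_expansion a L x ->
  (forall n, (0 < n)%N -> heavy_at m x n) ->
  forall k, odd k -> lt_length k L -> (m%:Z %| a k)%Z.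
Proof.
move=> m0 + + k; have [N] := ubnP k.
elim: N k a L x => // N IHN k a L x kN ax hx ok kL.
have L1 : lt_length 1 L by apply: lt_lengthW kL; case: (k) ok.
have [y [ay y1 xE]] := odd_cf_expansion_tail2 ax L1.
have [d d0 dE] := cf_expansion_nat1 ax.1 L1.
have y0 : 0 < y^-1 by rewrite invr_gt0 (lt_le_trans _ y1).
have y1' : y^-1 <= 1 by rewrite invf_le1 // -invr_gt0.
have hd n : (0 < n)%N -> heavy_at m (d%:R + y^-1)^-1 n.
  by move=> n0; have := hx n n0; rewrite xE dE heavy_at_addz.
have md := heavy_dvdn m0 d0 y0 y1' hd.
case: k ok kN kL => [|[|k]] // ok kN kL; first by rewrite dE.
rewrite -[a k.+2]/(tail (tail a) k).
apply: IHN ay _ _ _; [by lia| |by move: ok; rewrite /= negbK|by rewrite lt_length_pred2].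
by move=> n n0; rewrite -[y]invrK; apply: heavy_descend hd n0.
Qed.

(** The induction is on the time n, and not on the length of the expansion, which
    may be infinite. *)
Lemma dvdz_heavy m a L x : (0 < m)%N -> odd_cf_expansion a L x ->
  (forall k, odd k -> lt_length k L -> (m%:Z %| a k)%Z) ->
  forall n, (0 < n)%N -> heavy_at m x n.
Proof.
move=> m0 + + n; have [N] := ubnP n.
elim: N n a L x => // N IHN n a L x nN ax ha n0.
have [L1|L1] := boolP (lt_length 1 L); last first.
  case: L L1 ax {ha} => // -[|[|l]] // _ [[_ /= [// _ ->]] _].
  exact: heavy_at_int.
have [y [ay y1 xE]] := odd_cf_expansion_tail2 ax L1.
have [d d0 dE] := cf_expansion_nat1 ax.1 L1.
have y0 : 0 < y^-1 by rewrite invr_gt0 (lt_le_trans _ y1).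
have y1' : y^-1 <= 1 by rewrite invf_le1 // -invr_gt0.
have md : (m %| d)%N by have := ha 1%N isT L1; rewrite dE.
rewrite xE dE heavy_at_addz; apply: heavy_ascend => // k /andP[k0 kn].
rewrite invrK; apply: IHN ay _ k0; first by lia.
by move=> j oj; rewrite lt_length_pred2 => /ha; apply; rewrite /= negbK.
Qed.

End Equivalence.

Theorem theorem1 (R : realType) (alpha : R) (a : nat -> int) (L : option nat)
    (m : nat) (hm : (0 < m)%N) (ha : odd_cf_expansion a L alpha) :
  (Hset m alpha <->
   (forall k : nat, odd k -> (1 <= k)%N -> lt_length k L ->
      (m%:Z %| a k)%Z)) /\
  ((forall k : nat, odd k -> (1 <= k)%N -> lt_length k L ->
      (m%:Z %| a k)%Z) <->
   (forall k : nat, odd k -> (1 <= k)%N -> lt_length k L ->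
      (m%:Z %| cf_denom a k)%Z)).
Proof.
split; last by apply: dvdz_cf_denom => j k; apply: lt_lengthW.
rewrite HsetP //; split=> h.
  by move=> k ok _; apply: heavy_dvdz ha h k ok.
apply: dvdz_heavy ha _ => // k ok kL.
by apply: h => //; case: k ok kL.
Qed.
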